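(* Let $1<p\le n$. Let $\mathbf{X}$ be a deterministic $n\times p$ matrix with $\mathbf{X}^T\mathbf{X}=\mathbf{I}_p$, let $\boldsymbol\beta_0=(\beta_1,0,\dots,0)^T\in\mathbb{R}^p$ with $\beta_1\neq 0$, let $\sigma>0$, and let $\mathbf{y}=\mathbf{X}\boldsymbol\beta_0+\boldsymbol\varepsilon$ with $\varepsilon_1,\dots,\varepsilon_n$ i.i.d. $N(0,\sigma^2)$. Set $\mathbf z=(z_1,\dots,z_p)^T=\mathbf{X}^T\mathbf{y}$. For $\lambda\ge 0$ define $$L_p(\lambda)=\frac1n\Big(\beta_1-\operatorname{sgn}(z_1)(|z_1|-\lambda)_+\Big)^2+\frac1n\sum_{j=2}^p\big((|z_j|-\lambda)_+\big)^2,\qquad L_1(\lambda)=\frac1n\Big(\beta_1-\operatorname{sgn}(z_1)(|z_1|-\lambda)_+\Big)^2,$$ and let $L_p(\lambda_p^* )=\min_{\lambda\ge0}L_p(\lambda)$ and $L_1(\lambda_1^* )=\min_{\lambda\ge 0}L_1(\lambda)$. Then $$\Pr\Big(L_p(\lambda_p^* )>L_1(\lambda_1^* )\Big)=\Phi\!\left(\frac{|\beta_1|}{\sigma}\right)-\frac{1}{2p},$$ where $\Phi$ is the standard normal cumulative distribution function. (The paper writes the event as $L_p(\lambda_p^* )/L_1(\lambda_1^* )>1$.)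
   Context: Here $(a)_+=\max(a,0)$ and $\operatorname{sgn}$ is the sign function. For $\lambda\ge0$, $\hat\beta_{\lambda j}=\operatorname{sgn}(z_j)(|z_j|-\lambda)_+$ is the Lasso estimate under the orthonormal design, so $L_p(\lambda)=\|\mathbf X\boldsymbol\beta_0-\mathbf X\hat{\boldsymbol\beta}_\lambda\|^2/n$ is the $L_2$ loss of the Lasso using all $p$ predictors, and $L_1(\lambda)$ is the loss of the Lasso using only the first (true) predictor. $\lambda_p^*$ denotes a minimizer of $L_p$ over $\lambda\in[0,\infty)$. *)

(* Defs.v *)
From HB Require Import structures.
From mathcomp Require Import all_boot all_order all_algebra.
From mathcomp Require Import all_classical all_reals all_analysis.
Set Implicit Arguments. Unset Strict Implicit. Unset Printing Implicit Defensive.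
Import Order.TTheory GRing.Theory Num.Theory.
Import numFieldNormedType.Exports.
Local Open Scope classical_set_scope.
Local Open Scope ring_scope.

Section Defs.
Context {R : realType}.

(* soft thresholding: sgn(x) (|x| - l)_+  (Lasso under orthonormal design) *)
Definition soft (l x : R) : R := Num.sg x * Num.max (`|x| - l) 0.

Definition beta0 (p : nat) (beta1 : R) : 'cV[R]_p :=
  \col_(j < p) (if val j == 0%N then beta1 else 0).

Definition Lp (n p : nat) (beta1 : R) (z : 'cV[R]_p) (l : R) : R :=
  n%:R^-1 * \sum_(j < p) (beta0 p beta1 j 0 - soft l (z j 0)) ^+ 2.

Definition L1 (n p : nat) (beta1 : R) (z : 'cV[R]_p) (l : R) : R :=
  n%:R^-1 * \sum_(j < p | val j == 0%N) (beta0 p beta1 j 0 - soft l (z j 0)) ^+ 2.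

(* minimal value over lambda >= 0 (the minimum is attained) *)
Definition minval (L : R -> R) : R := inf [set L l | l in [set l : R | 0 <= l]].

Definition Phi (x : R) : \bar R := normal_prob 0 1 `]-oo, x].

End Defs.

Definition mutually_independent {R : realType} d (T : measurableType d)
    (P : probability T R) (n : nat) (X : 'I_n -> {RV P >-> R}) : Prop :=
  forall B : 'I_n -> set R, (forall i, measurable (B i)) ->
    P (\bigcap_(i in [set: 'I_n]) (X i @^-1` B i)) =
    (\prod_(i < n) P (X i @^-1` B i))%E.

Definition zvec {R : realType} d (T : measurableType d) (P : probability T R)
    (n p : nat) (X : 'M[R]_(n, p)) (beta1 : R) (eps : 'I_n -> {RV P >-> R})
    (w : T) : 'cV[R]_p :=
  X^T *m (X *m beta0 p beta1 + \col_(i < n) eps i w).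

(* Main.v *)
(** Put [u = X^T eps], [b = |beta1|] and [v = sgn(beta1) u_1].  Pointwise, the
    full Lasso does strictly worse than the one-predictor Lasso iff [v > - b] and
    [max(v, 0) < |u_j|] for some [j >= 2]: otherwise a single threshold minimizes
    the one-predictor loss and kills all the other predictors.  The [u_j] are
    i.i.d. [N(0, sigma^2)] because Givens rotations turn the orthonormal columns of
    [X] into signed unit vectors, and a rotation of two coordinates, being a
    product of three shears, preserves Lebesgue measure on the plane.  Up to ties,
    which have probability 0, the event is therefore [{v > - b}] minus the event
    that [v] exceeds all the [|u_j|] with [j >= 2]; the latter is one of [2 p]
    equiprobable events (choose the largest [|u_i|] and its sign) that partition
    the space up to ties, and has probability [1 / (2 p)]. *)

Require Import Defs.
From HB Require Import structures.
From mathcomp Require Import all_boot all_order all_algebra.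
From mathcomp Require Import all_classical all_reals all_analysis.
From mathcomp Require Import perm measurable_realfun ring lra.
Import Order.TTheory GRing.Theory Num.Theory.
Local Open Scope classical_set_scope.
Local Open Scope ring_scope.

(** * Comparison of the two losses *)

Section loss_comparison.
Context {R : realType}.
Implicit Types (L : R -> R) (l x b z : R).

Lemma softN l x : soft l (- x) = - soft l x.
Proof. by rewrite /soft sgrN normrN mulNr. Qed.

Lemma soft_ge0 l x : 0 <= x -> 0 <= l -> soft l x = Num.max (x - l) 0.
Proof.
rewrite /soft le_eqVlt => /predU1P[<- l0|x0 _].
  by rewrite sgr0 mul0r sub0r; apply/esym/max_idPr; rewrite oppr_le0.
by rewrite gtr0_sg// mul1r gtr0_norm.
Qed.

Lemma soft_sq l x : x != 0 -> soft l x ^+ 2 = Num.max (`|x| - l) 0 ^+ 2.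
Proof. by move=> x0; rewrite /soft exprMn sqr_sg x0 mul1r. Qed.

Lemma soft_large l x : `|x| <= l -> soft l x = 0.
Proof.
by move=> xl; rewrite /soft (max_idPr _) ?mulr0// subr_le0.
Qed.

Lemma soft_le0 l x : x <= 0 -> soft l x <= 0.
Proof.
by move=> x0; rewrite /soft mulr_le0_ge0 ?sgr_le0// le_max lexx orbT.
Qed.

Lemma minval_le L l : (forall k, 0 <= k -> 0 <= L k) -> 0 <= l ->
  minval L <= L l.
Proof.
move=> L0 l0; apply: ge_inf; last by exists l.
by exists 0 => _ [k k0 <-]; exact: L0.
Qed.

Lemma minval_ge L c : (forall l, 0 <= l -> c <= L l) -> c <= minval L.
Proof.
move=> Lc; apply: lb_le_inf; first by exists (L 0), 0 => //=.
by move=> _ [k k0 <-]; exact: Lc.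
Qed.

(** If [z >= b], the threshold [z - b] moves the estimate exactly onto [b]. If [z < b], shrinking
    only moves it further from [b], so the threshold 0 is best. *)
Lemma loss_min b z l : 0 < b -> 0 < z -> 0 <= l ->
  (b - soft (Num.max (z - b) 0) z) ^+ 2 <= (b - soft l z) ^+ 2.
Proof.
move=> b0 z0 l0; have az : Num.max (z - b) 0 < z.
  by rewrite gt_max z0 andbT ltrBlDr ltrDl.
have a0 : 0 <= Num.max (z - b) 0 by rewrite le_max lexx orbT.
rewrite !soft_ge0 ?(ltW z0)//.
rewrite (max_idPl _) ?subr_ge0 ?(ltW az)//.
have [zb|zb] := leP (z - b) 0.
  rewrite ler_sqr ?nnegrE; have [] := leP (z - l) 0 => ?; lra.
by rewrite (_ : b - _ = 0) ?expr0n ?sqr_ge0//; ring.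
Qed.

(* For small [l] the penalty paid for [x] is bounded below; for large [l] the
   shrinkage of [z] beyond [b] is. *)
Lemma loss_gap b z x : 0 < b -> 0 < z -> Num.max (z - b) 0 < `|x| ->
  exists2 e, 0 < e & forall l, 0 <= l ->
    (b - soft (Num.max (z - b) 0) z) ^+ 2 + e <=
    (b - soft l z) ^+ 2 + soft l x ^+ 2.
Proof.
move=> b0 z0; have := loss_min _ _ _ b0 z0.
set a := Num.max (z - b) 0 => amin ax.
have a0 : 0 <= a by rewrite /a le_max lexx orbT.
have x0 : x != 0 by rewrite -normr_gt0; exact: le_lt_trans ax.
(* Thresholds are split at the midpoint [a + d] between [a] and [|x|]. Below it [x] retains at least
   [d]; above it [z] loses at least [h] more than at [a], where [h] is capped by [z - a] because the
   estimate stops at 0. *)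
set d := (`|x| - a) / 2.
have d0 : 0 < d by rewrite divr_gt0// subr_gt0.
have dE : `|x| = a + 2 * d by rewrite /d; field.
have az : a < z by rewrite /a gt_max z0 andbT ltrBlDr ltrDl.
pose h := Num.min d (z - a).
have h0 : 0 < h by rewrite lt_min d0 subr_gt0.
exists (h ^+ 2); first by rewrite exprn_gt0.
have hd : h <= d by rewrite ge_min lexx.
have hz : h <= z - a by rewrite ge_min lexx orbT.
have cb : 0 <= b - (z - a) by rewrite /a; case: (leP (z - b) 0) => ?; lra.
move=> l l0; have [lad|lad] := leP l (a + d).
  apply: lerD; first exact: amin.
  rewrite soft_sq// dE ler_sqr ?nnegrE ?(ltW h0) ?le_max ?lexx ?orbT//.
  by apply/orP; left; lra.
apply: (@le_trans _ _ ((b - soft l z) ^+ 2)); last by rewrite lerDl sqr_ge0.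
rewrite !soft_ge0 ?(ltW z0)// (max_idPl _) ?subr_ge0 ?(ltW az)//.
(* The residual [b - (z - a)] is nonnegative by [cb], so increasing it by [h] adds at least [h ^+ 2]
   to its square. *)
apply: (@le_trans _ _ ((b - (z - a) + h) ^+ 2)); first by nra.
rewrite ler_sqr ?nnegrE; have [] := leP (z - l) 0 => ?; lra.
Qed.

Lemma soft_signed b l z : b != 0 ->
  (b - soft l z) ^+ 2 = (`|b| - soft l (Num.sg b * z)) ^+ 2.
Proof.
case: sgrP => [//|b0 _|b0 _]; first by rewrite mul1r.
by rewrite mulN1r softN opprK -sqrrN opprB addrC.
Qed.

Variables (n q : nat) (b1 : R) (y : 'cV[R]_q.+1).
Hypotheses (n0 : (0 < n)%N) (b10 : b1 != 0).

(** With [y] the vector [z] of the model, this [v] is the [v] of the overview plus [|b1|]. *)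
Let v := Num.sg b1 * y ord0 0.

Lemma L1E l : L1 n b1 y l = n%:R^-1 * (`|b1| - soft l v) ^+ 2.
Proof.
rewrite /L1 (big_pred1 ord0)//.
by rewrite mxE eqxx soft_signed.
Qed.

Lemma LpE l : Lp n b1 y l =
  n%:R^-1 * ((`|b1| - soft l v) ^+ 2 + \sum_(j < q.+1 | j != ord0) soft l (y j 0)
    ^+ 2).
Proof.
rewrite /Lp (bigD1 ord0)//= mxE eqxx soft_signed//; congr (_ * (_ + _)).
by apply: eq_bigr => j j0; rewrite mxE -val_eqE/= in j0 *;
  rewrite (negbTE j0) sub0r sqrrN.
Qed.

(** [minval] is an infimum, so strictness comes from a gap uniform in the threshold, provided by
    [loss_gap]. Conversely, if the right-hand side fails, some minimizer of the one-predictor loss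
    kills all the other predictors. *)
Lemma minval_L1_lt_Lp :
  minval (L1 n b1 y) < minval (Lp n b1 y) <->
  0 < v /\ exists2 j, j != ord0 & Num.max (v - `|b1|) 0 < `|y j 0|.
Proof.
have nV : 0 < n%:R^-1 :> R by rewrite invr_gt0 ltr0n.
have b0 : 0 < `|b1| by rewrite normr_gt0.
have L10 l : 0 <= l -> 0 <= L1 n b1 y l.
  by move=> _; rewrite L1E mulr_ge0 ?sqr_ge0// ltW.
have Lp0 l : 0 <= l -> 0 <= Lp n b1 y l.
  move=> _; rewrite LpE mulr_ge0 ?(ltW nV)// addr_ge0 ?sqr_ge0//.
  by apply: sumr_ge0 => *; rewrite sqr_ge0.
have a0 : 0 <= Num.max (v - `|b1|) 0 by rewrite le_max lexx orbT.
split=> [lt1p|[v0 [j j0 yj]]]; last first.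
  have [e e0 gap] := loss_gap _ _ _ b0 v0 yj.
  apply: le_lt_trans (minval_le _ _ L10 a0) _.
  apply: (@lt_le_trans _ _ (L1 n b1 y (Num.max (v - `|b1|) 0) + n%:R^-1 * e)).
    by rewrite ltrDl mulr_gt0.
  apply: minval_ge => l l0; rewrite L1E LpE -mulrDr ler_pM2l//.
  apply: le_trans (gap l l0) _; rewrite lerD2l (bigD1 j)//= lerDl.
  by apply: sumr_ge0 => *; rewrite sqr_ge0.
have absurd l : 0 <= l -> (forall j, j != ord0 -> `|y j 0| <= l) ->
    (forall k, 0 <= k -> (`|b1| - soft l v) ^+ 2 <= (`|b1| - soft k v) ^+ 2) ->
  False.
  move=> l0 yl lmin; suff : minval (Lp n b1 y) <= minval (L1 n b1 y).
    by rewrite leNgt lt1p.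
  apply: (le_trans (minval_le _ _ Lp0 l0)); apply: minval_ge => k k0.
  rewrite LpE big1 ?addr0; last first.
    by move=> j j0; rewrite soft_large ?expr0n//; exact: yl.
  by rewrite L1E ler_pM2l//; exact: lmin.
have [v0|v0] := leP v 0; last first.
  split=> //; apply: contrapT => noj; apply: (absurd _ a0).
    by move=> j j0; rewrite leNgt; apply/negP => yj; apply: noj; exists j.
  by move=> k k0; exact: loss_min.
(* For [v <= 0] every estimate has the wrong sign or is 0, so 0 is best. The sum of all absolute
   values is a threshold that kills every coordinate, the first included. *)
have yle j : `|y j 0| <= \sum_j `|y j 0|.
  by rewrite (bigD1 j)//= lerDl sumr_ge0.
exfalso; apply: (absurd (\sum_j `|y j 0|)); first by rewrite sumr_ge0.
  by move=> j _; exact: yle.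
move=> k k0; rewrite [soft (\sum__ _) _]soft_large; last first.
  by rewrite /v normrM normr_sg b10 mul1r.
rewrite ler_sqr ?nnegrE; have := soft_le0 k _ v0; lra.
Qed.

End loss_comparison.

(** * Rotation invariance of the planar normal law *)

Section lebesgue_affine.
Context {R : realType}.
Local Notation mu := (@lebesgue_measure R).
Implicit Types (a : R) (A : set R).

Lemma preimage_shift_itvoc a x y :
  (fun t : R => t + a) @^-1` `]x, y] = `]x - a, y - a]%classic.
Proof.
by apply/seteqP; split=> t /=; rewrite !in_itv/= ltrBlDr lerBrDr.
Qed.

Lemma lebesgue_measure_shift a A : measurable A ->
  pushforward mu ((fun t => t + a) : _ -> measurableTypeR R) A = mu A.
Proof.
move=> mA; apply/esym/lebesgue_measure_unique => //=.
  exact: measurable_funD.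
move=> mf _ [[x y]] _ <-.
rewrite /pushforward/= preimage_shift_itvoc !lebesgue_measure_itv/= !lte_fin ltrD2r.
by case: ifPn => // _; rewrite -!EFinD; congr EFin; ring.
Qed.

Lemma ge0_integral_shift a (f : R -> \bar R) : measurable_fun setT f ->
  (forall x, 0 <= f x)%E ->
  (\int[mu]_x f (x + a)%R = \int[mu]_x f x)%E.
Proof.
move=> mf f0.
have mD : measurable_fun [set: R] ((fun t => t + a) : R -> measurableTypeR R).
  exact: measurable_funD.
transitivity (\int[pushforward mu ((fun t => t + a)%R : _ -> measurableTypeR
  R)]_x f x)%E.
  by rewrite ge0_integral_pushforward.
by apply: eq_measure_integral => //= A mA _; exact: lebesgue_measure_shift.
Qed.

Lemma ge0_integral_opp (f : R -> \bar R) : measurable_fun setT f ->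
  (forall x, 0 <= f x)%E ->
  (\int[mu]_x f (- x)%R = \int[mu]_x f x)%E.
Proof.
move=> mf f0.
have mN : measurable_fun [set: R] (-%R : R -> measurableTypeR R) by [].
transitivity (\int[pushforward mu (-%R : _ -> measurableTypeR R)]_x f x)%E.
  by rewrite ge0_integral_pushforward.
by apply: eq_measure_integral => //= A mA _; exact: lebesgue_measureN.
Qed.

(** The image of Lebesgue measure under multiplication by [a], rescaled by [a], gives half-open
    intervals their length, hence is Lebesgue measure. *)
Lemma ge0_integral_scale (a : {posnum R}) (f : R -> \bar R) :
  measurable_fun setT f -> (forall x, 0 <= f x)%E ->
  (a%:num%:E * \int[mu]_x f (a%:num * x)%R = \int[mu]_x f x)%E.
Proof.
move=> mf f0; set k := ( *%R a%:num : R -> measurableTypeR R).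
have mk : measurable_fun [set: R] k by exact: measurable_funM.
unshelve refine (let nu : {measure set (measurableTypeR R) -> \bar R} :=
  pushforward mu k in _); first exact: mk.
transitivity (\int[mscale a%:num%:nng%R nu]_x f x)%E.
  by rewrite ge0_integral_mscale//= ge0_integral_pushforward.
apply: eq_measure_integral => //= A mA _; apply/esym/lebesgue_measure_unique => //.
move=> _ [[x y]] _ <-.
rewrite /= /mscale/= /nu/= /pushforward (_ : k @^-1` _ = `]x / a%:num, y /
  a%:num]%classic).
  rewrite !lebesgue_measure_itv/= !lte_fin ltr_pM2r ?invr_gt0//.
  case: ifPn => _; last by rewrite mule0.
  by rewrite -!EFinD -EFinM; congr EFin; field.
by apply/seteqP; split=> t /=;
  rewrite /k !in_itv/= ltr_pdivrMr// ler_pdivlMr// mulrC.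
Qed.

(** Tonelli makes [x] the inner variable; for fixed [y] the shear is then a translation. *)
Lemma ge0_integral2_shear1 (t : R) (f : R * R -> \bar R) : measurable_fun setT f ->
  (forall z, 0 <= f z)%E ->
  (\int[mu]_x \int[mu]_y f (x + t * y, y)%R = \int[mu]_x \int[mu]_y f (x, y))%E.
Proof.
move=> mf f0.
have mS : measurable_fun setT (fun z : R * R => (z.1 + t * z.2, z.2)).
  apply: measurable_fun_pair => //=; apply: measurable_funD => //.
  exact: measurable_funM.
have := fubini_tonelli (m1 := mu) (m2 := mu) _ (measurableT_comp mf mS) (fun=> f0
  _).
move=> /= ->; have := fubini_tonelli (m1 := mu) (m2 := mu) _ mf f0 => ->;
  apply: eq_integral => y _ /=.
rewrite (ge0_integral_shift _ (fun x => f (x, y)))//.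
exact: measurableT_comp mf (measurable_pair2 y).
Qed.

Lemma ge0_integral2_shear2 (t : R) (f : R * R -> \bar R) : measurable_fun setT f ->
  (forall z, 0 <= f z)%E ->
  (\int[mu]_x \int[mu]_y f (x, y + t * x)%R = \int[mu]_x \int[mu]_y f (x, y))%E.
Proof.
move=> mf f0; apply: eq_integral => x _ /=.
rewrite (ge0_integral_shift _ (fun y => f (x, y)))//.
exact: measurableT_comp mf (measurable_pair1 x).
Qed.

(* For [c = cos theta] and [s = sin theta] the rotation is a product of three
   shears, with parameters [tan (theta / 2)], [- sin theta] and [tan (theta / 2)]. *)
Lemma ge0_integral2_rotation (c s : R) (f : R * R -> \bar R) :
  c ^+ 2 + s ^+ 2 = 1 -> s != 0 ->
  measurable_fun setT f -> (forall z, 0 <= f z)%E ->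
  (\int[mu]_x \int[mu]_y f (c * x + s * y, - s * x + c * y)%R =
   \int[mu]_x \int[mu]_y f (x, y))%E.
Proof.
(* This is [tan (theta / 2)]. The identities [ts] and [tc] below identify the composite of the three
   shears with the rotation. *)
move=> cs1 s0 mf f0; pose t := (1 - c) / s.
have mS1 : measurable_fun setT (fun z : R * R => (z.1 + t * z.2, z.2)).
  apply: measurable_fun_pair => //=; apply: measurable_funD => //.
  exact: measurable_funM.
have mS2 : measurable_fun setT (fun z : R * R => (z.1, z.2 + - s * z.1)).
  apply: measurable_fun_pair => //=; apply: measurable_funD => //.
  exact: measurable_funM.
rewrite -(ge0_integral2_shear1 t _ mf f0).
have mf1 := measurableT_comp mf mS1.
have /= <- := ge0_integral2_shear2 (- s) _ mf1 (fun=> f0 _).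
have /= <- := ge0_integral2_shear1 t _ (measurableT_comp mf1 mS2) (fun=> f0 _).
have ts : t * s = 1 - c by rewrite /t divfK.
have tc : t * (1 + c) = s.
  by rewrite /t mulrAC -subr_sqr expr1n -cs1 addrAC subrr add0r expr2 mulfK.
apply: eq_integral => x _; apply: eq_integral => y _ /=; congr (f (_, _)).
  apply/esym; transitivity (x * (1 - t * s) + t * (1 + (1 - t * s)) * y);
    first by ring.
  by rewrite ts subKr tc; ring.
by apply/esym; transitivity (- s * x + (1 - t * s) * y); [ring|rewrite ts subKr].
Qed.

End lebesgue_affine.

(** * The centred normal law on the line and in the plane *)

Section normal.
Context {R : realType}.
Local Notation mu := (@lebesgue_measure R).
Implicit Types (s x : R) (A B : set R).

Lemma normal_pdf0E s x : s != 0 ->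
  normal_pdf 0 s x = normal_peak s * expR (- x ^+ 2 / (s ^+ 2 *+ 2)).
Proof. by move=> s0; rewrite normal_pdfE// /normal_fun subr0. Qed.

Lemma normal_probE s A :
  normal_prob 0 s A = (\int[mu]_x (normal_pdf 0 s x * \1_A x)%:E)%E.
Proof.
rewrite /normal_prob integral_mkcond; apply: eq_integral => x _.
by rewrite patchE indicE; case: ifPn => _; rewrite ?mulr1 ?mulr0.
Qed.

Lemma measurable_pdf_indic s A : measurable A ->
  measurable_fun setT (fun x => (normal_pdf 0 s x * \1_A x)%:E).
Proof.
move=> mA; apply/measurable_EFinP; apply: measurable_funM => //.
exact: measurable_normal_pdf.
Qed.

Lemma pdf_indic_ge0 s A x : (0 <= (normal_pdf 0 s x * \1_A x)%:E)%E.
Proof. by rewrite lee_fin mulr_ge0 ?normal_pdf_ge0 ?indicE. Qed.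

Lemma normal_prob_opp s A : s != 0 -> measurable A ->
  normal_prob 0 s (-%R @^-1` A) = normal_prob 0 s A.
Proof.
move=> s0 mA; rewrite !normal_probE.
rewrite -(ge0_integral_opp _ (measurable_pdf_indic s _ mA) (pdf_indic_ge0 s A)).
by apply: eq_integral => x _; rewrite !normal_pdf0E// sqrrN.
Qed.

Lemma normal_prob_set1 s x : normal_prob 0 s [set x] = 0%E.
Proof. exact: integral_set1. Qed.

(** Substituting [s * y] for the variable turns [s] times the density of [N(0, s^2)] into the
    standard density. *)
Lemma normal_prob_itvNyc s x : 0 < s -> normal_prob 0 s `]-oo, x] = Phi (x / s).
Proof.
move=> s0; rewrite /Phi !normal_probE -(ge0_integral_scale (PosNum s0))/=;
  last 2 first.
- exact: measurable_pdf_indic.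
- exact: pdf_indic_ge0.
rewrite -ge0_integralZl//=; last 3 first.
- have mk : measurable_fun setT ( *%R s : R -> R) by exact: measurable_funM.
  exact: (measurableT_comp (measurable_pdf_indic s _ (measurable_itv _)) mk).
- by move=> y _; exact: pdf_indic_ge0.
- by rewrite lee_fin ltW.
apply: eq_integral => y _; rewrite -EFinM; congr EFin.
rewrite mulrA; congr (_ * _); last first.
  by rewrite !indicE; congr ((_ : bool)%:R); apply/idP/idP;
    rewrite !inE/= !in_itv/= ler_pdivlMr// mulrC.
rewrite !normal_pdf0E ?oner_eq0 ?gt_eqF// mulrA; congr (_ * expR _).
  rewrite /normal_peak expr1n mul1r -mulrnAr sqrtrM ?sqr_ge0// sqrtr_sqr
    gtr0_norm//.
  by rewrite invfM mulVKf// gt_eqF.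
by rewrite expr1n; field; rewrite gt_eqF.
Qed.

Definition normal_pdf2 s (z : R * R) := normal_pdf 0 s z.1 * normal_pdf 0 s z.2.

Lemma normal_pdf2_ge0 s z : 0 <= normal_pdf2 s z.
Proof. by rewrite mulr_ge0 ?normal_pdf_ge0. Qed.

Lemma measurable_normal_pdf2 s : measurable_fun setT (normal_pdf2 s).
Proof.
by apply: measurable_funM; apply: measurableT_comp => //;
  exact: measurable_normal_pdf.
Qed.

Lemma normal_pdf2_rotation s (c d x y : R) : s != 0 -> c ^+ 2 + d ^+ 2 = 1 ->
  normal_pdf2 s (c * x + d * y, - d * x + c * y) = normal_pdf2 s (x, y).
Proof.
move=> s0 cd1; rewrite /normal_pdf2/= !normal_pdf0E//.
rewrite mulrACA [RHS]mulrACA -!expRD; congr (_ * expR _).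
rewrite -!mulrDl -!opprD; congr (- _ / _).
transitivity ((c ^+ 2 + d ^+ 2) * (x ^+ 2 + y ^+ 2)); first by ring.
by rewrite cd1 mul1r.
Qed.

(** Defined by a density, so that rotation invariance follows from that of Lebesgue measure and of
    [x^2 + y^2]. The measure structure below allows comparison with other measures on rectangles
    alone. *)
Definition normal_prob2 s (C : set (R * R)) : \bar R :=
  (\int[mu \x mu]_(z in C) (normal_pdf2 s z)%:E)%E.

Let normal_prob2_0 s : normal_prob2 s set0 = 0%E.
Proof. exact: integral_set0. Qed.

Let normal_prob2_ge0 s C : (0 <= normal_prob2 s C)%E.
Proof. by apply: integral_ge0 => z _; rewrite lee_fin normal_pdf2_ge0. Qed.

Let normal_prob2_sigma_additive s : semi_sigma_additive (normal_prob2 s).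
Proof.
move=> A mA tA mUA; rewrite /normal_prob2 ge0_integral_bigcup//.
- apply: is_cvg_ereal_nneg_natsum_cond => n _ _; exact: normal_prob2_ge0.
- apply/measurable_EFinP; apply: measurable_funTS; exact: measurable_normal_pdf2.
- by move=> z _; rewrite lee_fin normal_pdf2_ge0.
Qed.

HB.instance Definition _ s := isMeasure.Build _ _ _ (normal_prob2 s)
  (normal_prob2_0 s) (normal_prob2_ge0 s) (@normal_prob2_sigma_additive s).

Lemma measurable_pdf2_indic s (C : set (R * R)) : measurable C ->
  measurable_fun setT (fun z => (normal_pdf2 s z * \1_C z)%:E).
Proof.
move=> mC; apply/measurable_EFinP; apply: measurable_funM => //.
exact: measurable_normal_pdf2.
Qed.

Lemma pdf2_indic_ge0 s (C : set (R * R)) z : (0 <= (normal_pdf2 s z * \1_C z)%:E)%E.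
Proof. by rewrite lee_fin mulr_ge0 ?normal_pdf2_ge0 ?indicE. Qed.

Lemma normal_prob2E s (C : set (R * R)) : measurable C -> normal_prob2 s C =
  (\int[mu]_x \int[mu]_y (normal_pdf2 s (x, y) * \1_C (x, y))%:E)%E.
Proof.
move=> mC; rewrite /normal_prob2 integral_mkcond.
rewrite -[RHS](fubini_tonelli1 (m1 := mu) (m2 := mu)
  _ (measurable_pdf2_indic s _ mC) (pdf2_indic_ge0 s C)).
apply: eq_integral => z _.
by rewrite patchE indicE; case: ifPn => _; rewrite ?mulr1 ?mulr0.
Qed.

Lemma normal_prob2X s A B : measurable A -> measurable B ->
  normal_prob2 s (A `*` B) = (normal_prob 0 s A * normal_prob 0 s B)%E.
Proof.
move=> mA mB; rewrite normal_prob2E; last exact: measurableX.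
rewrite !normal_probE -ge0_integralZr//; last 3 first.
- exact: measurable_pdf_indic.
- by move=> x _; exact: pdf_indic_ge0.
- by apply: integral_ge0 => x _; exact: pdf_indic_ge0.
apply: eq_integral => x _; rewrite -ge0_integralZl//; last 3 first.
- exact: measurable_pdf_indic.
- by move=> y _; exact: pdf_indic_ge0.
- exact: pdf_indic_ge0.
apply: eq_integral => y _; rewrite -EFinM; congr EFin.
rewrite /normal_pdf2/= !indicE in_setX/= mulrACA; congr (_ * _).
by case: (_ \in _); rewrite ?mul1r ?mul0r.
Qed.

Lemma normal_prob2_rotation s (c d : R) (C : set (R * R)) : s != 0 ->
  c ^+ 2 + d ^+ 2 = 1 -> d != 0 -> measurable C ->
  normal_prob2 s ((fun z => (c * z.1 + d * z.2, - d * z.1 + c * z.2)) @^-1` C) =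
  normal_prob2 s C.
Proof.
move=> s0 cd1 d0 mC; set r := (fun z : R * R => _ : R * R).
have mr : measurable_fun setT r.
  by apply: measurable_fun_pair; apply: measurable_funD; apply: measurable_funM.
have mrC : measurable (r @^-1` C) by rewrite -[X in measurable X]setTI; exact: mr.
rewrite (normal_prob2E s _ mrC).
rewrite (normal_prob2E s _ mC).
have <- := ge0_integral2_rotation _ _ _ cd1 d0 (measurable_pdf2_indic s _ mC)
  (pdf2_indic_ge0 s C).
by apply: eq_integral => x _; apply: eq_integral => y _;
  rewrite normal_pdf2_rotation.
Qed.

End normal.

(** * Orthonormal combinations of i.i.d. normal variables *)

(** Measurable rectangles are stable under intersection and generate the product sigma-algebra. *)
Lemma measure_prod_ext d1 d2 (T1 : measurableType d1) (T2 : measurableType d2)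
    (R : realType) (m1 m2 : {measure set (T1 * T2) -> \bar R}) :
  (forall A B, measurable A -> measurable B -> m1 (A `*` B) = m2 (A `*` B)) ->
  (m1 setT < +oo)%E -> forall C, measurable C -> m1 C = m2 C.
Proof.
move=> m12 m1oo C mC.
apply: (measure_unique
  [set A `*` B | A in [set A | measurable A] & B in [set B | measurable B]]
  (fun=> setT)) => //.
- exact: measurable_prod_measurableType.
- move=> _ _ [A mA [B mB <-]] [A' mA' [B' mB' <-]]; rewrite -setXI.
  exists (A `&` A'); first exact: measurableI.
  by exists (B `&` B') => //; exact: measurableI.
- move=> i; exists setT; first exact: measurableT.
  by exists setT; [exact: measurableT|rewrite setXTT].
- by rewrite bigcup_const.
- by move=> _ [A mA [B mB <-]]; exact: m12.
Qed.

Section iid_normal.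
Context {R : realType} d (T : measurableType d) (P : probability T R) (s : R).
Hypothesis s0 : s != 0.
Local Notation N := (normal_prob 0 s).

(** Independence and the common law are merged into one product formula on boxes; taking all sides
    but one to be the whole line recovers the marginals. *)
Definition iid_normal n (f : 'I_n -> T -> R) : Prop :=
  (forall i, measurable_fun setT (f i)) /\
  forall B : 'I_n -> set R, (forall i, measurable (B i)) ->
    P (\bigcap_(i in [set: 'I_n]) (f i @^-1` B i)) = (\prod_(i < n) N (B i))%E.

Lemma iid_normal_marginal n (f : 'I_n -> T -> R) i A : iid_normal n f ->
  measurable A -> P (f i @^-1` A) = N A.
Proof.
move=> [mf fN] mA; pose B j := if j == i then A else setT.
have -> : f i @^-1` A = \bigcap_(j in setT) (f j @^-1` B j).
  apply/seteqP; split=> w /=; rewrite /B; last by move=> /(_ i I); rewrite eqxx.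
  by move=> ? j _; case: eqP => [->|].
rewrite fN => [|j]; last by rewrite /B; case: ifP.
rewrite (bigD1 i)//= {1}/B eqxx big1 ?mule1// => j /negbTE ji.
by rewrite /B ji; exact: probability_setT.
Qed.

Lemma normal_prob_sign (e : R) (A : set R) : measurable A -> e ^+ 2 = 1 ->
  N ((fun x => e * x) @^-1` A) = N A.
Proof.
move=> mA /eqP; rewrite sqrf_eq1 => /orP[] /eqP ->.
  by congr (N _); apply/seteqP; split=> x /=; rewrite mul1r.
rewrite -[RHS]normal_prob_opp//.
by congr (N _); apply/seteqP; split=> x /=; rewrite mulN1r.
Qed.

Lemma iid_normal_signed_sub m n (f : 'I_n -> T -> R) (h : 'I_m -> 'I_n)
    (e : 'I_m -> R) :
  injective h -> (forall a, e a ^+ 2 = 1) -> iid_normal n f ->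
  iid_normal m (fun a w => e a * f (h a) w).
Proof.
move=> hI e1 [mf fN]; split=> [a|B mB]; first exact: measurable_funM.
have mE a : measurable ((fun x => e a * x) @^-1` B a).
  have mk : measurable_fun setT (fun x : R => e a * x) by exact: measurable_funM.
  by rewrite -[X in measurable X]setTI; exact: mk.
(* The constraint put on [f k]: a single one if [k] is in the image of [h], by injectivity, and the
   whole line otherwise. *)
pose C k := \bigcap_(a in [set a | h a = k]) ((fun x => e a * x) @^-1` B a).
have mC k : measurable (C k).
  by apply: fin_bigcap_measurable => // a _; exact: mE.
have -> : \bigcap_(a in setT) ((fun w => e a * f (h a) w) @^-1` B a) =
          \bigcap_(k in setT) (f k @^-1` C k).
  apply/seteqP; split=> w /= Bw; first by move=> k _ a /= <-; exact: Bw.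
  by move=> a _; exact: (Bw (h a) I a).
rewrite fN//= (bigID (mem (h @: [set: 'I_m])%SET))/= big_imset/=;
  last by move=> ? ? _ _ /hI.
rewrite [X in (_ * X)%E]big1 ?mule1; last first.
  move=> k kh; rewrite [C k](_ : _ = setT); first exact: probability_setT.
  by apply/seteqP; split=> // x _ a /= ha; rewrite -ha imset_f ?inE in kh.
apply: eq_big => [a|a _]; first by rewrite inE.
rewrite [C _](_ : _ = (fun x => e a * x) @^-1` B a); first exact: normal_prob_sign.
by apply/seteqP; split=> x /=; [exact|move=> Bx b /= /hI ->].
Qed.

(** The rotation with cosine [a] and sine [b] in the plane of coordinates [i] and [j]. It will act
    both on rows of coefficients and on families of random variables. *)
Definition givens n (i j : 'I_n) (a b : R) (x : 'I_n -> R) (k : 'I_n) : R :=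
  if k == i then a * x i + b * x j
  else if k == j then - b * x i + a * x j else x k.

Lemma givens_dot n (i j : 'I_n) a b (x y : 'I_n -> R) : i != j ->
  a ^+ 2 + b ^+ 2 = 1 ->
  \sum_k givens n i j a b x k * givens n i j a b y k = \sum_k x k * y k.
Proof.
move=> ij ab1; have ji : (j == i) = false by rewrite eq_sym (negbTE ij).
rewrite (bigD1 i)//= (bigD1 j) ?ji//=.
rewrite [RHS](bigD1 i)//= [X in _ = _ + X](bigD1 j) ?ji//= !addrA.
rewrite /givens !eqxx ji; congr (_ + _).
  transitivity ((a ^+ 2 + b ^+ 2) * (x i * y i + x j * y j)); first by ring.
  by rewrite ab1 mul1r.
by apply: eq_bigr => k /andP[/negbTE -> /negbTE ->].
Qed.

(** Once the constraints on the other coordinates are imposed through [E], the pair [(f i, f j)]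
    follows [K] times the planar normal law, which the rotation preserves. *)
Lemma iid_normal_givens n (f : 'I_n -> T -> R) (i j : 'I_n) a b : i != j ->
  a ^+ 2 + b ^+ 2 = 1 -> b != 0 -> iid_normal n f ->
  iid_normal n (fun k w => givens n i j a b (f ^~ w) k).
Proof.
move=> ij ab1 b0 [mf fN].
have ji : (j == i) = false by rewrite eq_sym (negbTE ij).
split=> [k|B mB].
  rewrite /givens; case: (k == i); last case: (k == j) => //.
    by apply: measurable_funD; exact: measurable_funM.
  by apply: measurable_funD; exact: measurable_funM.
pose E := \bigcap_(k in [set k | (k != i) && (k != j)]) (f k @^-1` B k).
have mfB k A : measurable A -> measurable (f k @^-1` A).
  by move=> mA; rewrite -[X in measurable X]setTI; exact: mf.
have mE : measurable E.
  by apply: fin_bigcap_measurable => [|k _]; [exact: finite_finset|exact: mfB].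
pose K : \bar R := (\prod_(k | (k != i) && (k != j)) N (B k))%E.
have K0 : (0 <= K)%E by apply: prode_ge0 => k _; exact: measure_ge0.
have Kfin : K \is a fin_num.
  by apply: prode_fin_num => k _; exact: (fin_num_measure N _ (mB k)).
have box A A' : measurable A -> measurable A' ->
    P (f i @^-1` A `&` f j @^-1` A' `&` E) = (K * (N A * N A'))%E.
  move=> mA mA'.
  pose B' k := if k == i then A else if k == j then A' else B k.
  have -> : f i @^-1` A `&` f j @^-1` A' `&` E = \bigcap_(k in setT) (f k @^-1`
    B' k).
    apply/seteqP; split=> w /=.
      move=> [[Ai Aj] Ew] k _; rewrite /B' /=; case: eqP => [->//|/eqP ki].
      by case: eqP => [->//|/eqP kj]; apply: Ew; rewrite /= ki kj.
    move=> Bw; split; first split.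
    - by have := Bw i I; rewrite /B' eqxx.
    - by have := Bw j I; rewrite /B' eqxx ji.
    - by move=> k /= /andP[ki kj]; have := Bw k I;
      rewrite /B' (negbTE ki) (negbTE kj).
  rewrite fN => [|k]; last by rewrite /B'; do 2?case: ifP.
  rewrite (bigD1 i)//= (bigD1 j) ?ji//= {1 2}/B' !eqxx ji.
  rewrite muleA muleC; congr (_ * _)%E;
    apply: eq_bigr => k /andP[/negbTE ki /negbTE kj].
  by rewrite /B' ki kj.
pose g w := (f i w, f j w).
have mg : measurable_fun setT g by exact: measurable_fun_pair.
unshelve refine (let nu : {measure set (R * R) -> \bar R} :=
  pushforward (mrestr P mE) g in _); first exact: mg.
(* The rotated box is no longer a rectangle in the original coordinates, so the formula [box] is
   first extended to all measurable sets. *)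
have nuE C : measurable C -> nu C = (K * normal_prob2 s C)%E.
  move=> mC; rewrite -(fineK Kfin).
  pose k := NngNum (fine_ge0 K0).
  rewrite [RHS](_ : _ = mscale k (normal_prob2 s) C)//.
  apply: measure_prod_ext => //= [A A' mA mA'|].
    by rewrite /mscale/= fineK// normal_prob2X// -box.
  rewrite /nu/= /pushforward preimage_setT /mrestr setTI.
  by rewrite -ge0_fin_numE ?measure_ge0//; exact: (fin_num_measure P _ mE).
set r := (fun z : R * R => (a * z.1 + b * z.2, - b * z.1 + a * z.2)).
have mr : measurable_fun setT r.
  by apply: measurable_fun_pair; apply: measurable_funD; apply: measurable_funM.
have -> : \bigcap_(k in setT) ((fun w => givens n i j a b (f ^~ w) k) @^-1` B k) =
    (g @^-1` (r @^-1` (B i `*` B j))) `&` E.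
  apply/seteqP; split=> w /=.
    move=> Bw; split; first split.
    - by have := Bw i I; rewrite /= /givens eqxx.
    - by have := Bw j I; rewrite /= /givens eqxx ji.
    - by move=> k /= /andP[ki kj]; have := Bw k I;
      rewrite /= /givens (negbTE ki) (negbTE kj).
  move=> [[Bi Bj] Ew] k _; rewrite /= /givens; case: eqP => [->//|/eqP ki].
  by case: eqP => [->//|/eqP kj]; apply: Ew; rewrite /= ki kj.
have mBij : measurable (B i `*` B j) by exact: measurableX.
transitivity (nu (r @^-1` (B i `*` B j))); first by [].
rewrite nuE; last by rewrite -[X in measurable X]setTI; exact: mr.
rewrite normal_prob2_rotation// normal_prob2X//.
by rewrite [RHS](bigD1 i)//= (bigD1 j) ?ji//= muleA [RHS]muleC.
Qed.

End iid_normal.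

Arguments iid_normal {R d T} P s {n} f.
Arguments givens {R n} i j a b x k.
Arguments iid_normal_marginal {R d T P s n f} i {A}.
Arguments iid_normal_signed_sub {R d T P s} s0 {m n f h e}.
Arguments iid_normal_givens {R d T P s} s0 {n f i j a b}.

(** * Diagonalizing an orthonormal family by Givens rotations *)

Section elimination.
Context {R : realType} d (T : measurableType d) (P : probability T R) (s : R).
Hypothesis s0 : s != 0.
Variables (n p : nat).
Implicit Types (x y : 'I_p -> 'I_n -> R) (f g : 'I_n -> T -> R).

(** The invariant of the elimination: the same [p] random linear forms, rewritten with coefficients
    [y] over a new i.i.d. family [g], with an unchanged Gram matrix. *)
Definition same_forms x f y g : Prop := [/\ iid_normal P s g,
  forall a b, \sum_k y a k * y b k = \sum_k x a k * x b k &
  forall a w, \sum_k y a k * g k w = \sum_k x a k * f k w].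

Lemma same_forms_trans x f y g z h :
  same_forms x f y g -> same_forms y g z h -> same_forms x f z h.
Proof.
move=> [_ yx gf] [hN zy hg]; split=> // [a b|a w]; first by rewrite zy yx.
by rewrite hg gf.
Qed.

(** Each [j] in [r] is treated by a rotation in the plane of [i] and [j] that moves the entry of row
    [a] at [j] into the pivot [i]; entries already cleared are not touched. *)
Lemma givens_elimination x f (i : 'I_n) (a : 'I_p) (r : seq 'I_n) :
  iid_normal P s f -> i \notin r ->
  exists y g, [/\ same_forms x f y g, forall k, k \in r -> y a k = 0 &
    forall b k, k \notin i :: r -> y b k = x b k].
Proof.
move=> fN; elim: r => [_|j r IH].
  by exists x, f; split => //; split.
rewrite inE negb_or => /andP[ij ir]; have [y [g [yg yr yx]]] := IH ir.
have yxW b k : k \notin [:: i, j & r] -> y b k = x b k.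
  rewrite !inE !negb_or => /and3P[ki _ kr]; apply: yx.
  by rewrite inE negb_or ki kr.
(* An entry that is already 0 is skipped, so every rotation used has a nonzero sine. *)
have [yj0|yj0] := eqVneq (y a j) 0.
  exists y, g; split => // k; rewrite inE => /predU1P[->//|]; exact: yr.
have q0 : 0 < y a i ^+ 2 + y a j ^+ 2.
  by rewrite ltr_wpDl ?sqr_ge0// exprn_even_gt0.
set q := Num.sqrt (y a i ^+ 2 + y a j ^+ 2).
have qN0 : q != 0 by rewrite gt_eqF// sqrtr_gt0.
pose u := y a i / q; pose v := y a j / q.
have uv1 : u ^+ 2 + v ^+ 2 = 1.
  by rewrite !expr_div_n -mulrDl sqr_sqrtr ?ltW// divff// gt_eqF.
have v0 : v != 0 by rewrite mulf_neq0// invr_eq0.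
exists (fun b => givens i j u v (y b)), (fun k w => givens i j u v (g ^~ w) k).
have [gN gram pair] := yg.
split.
- apply: same_forms_trans yg _; split.
  + exact: iid_normal_givens.
  + by move=> b c; exact: givens_dot.
  + by move=> b w; exact: givens_dot.
- move=> k; rewrite inE /givens => /predU1P[->|kr].
    by rewrite eq_sym (negbTE ij) eqxx /u /v; field.
  have -> : k == i = false by apply: contraNF ir => /eqP <-.
  have [_|_] := eqVneq k j; last exact: yr.
  by rewrite /u /v; field.
- move=> b k kijr; rewrite /givens -(yxW b k kijr).
  by move: kijr; rewrite !inE !negb_or => /and3P[/negbTE -> /negbTE ->].
Qed.

Lemma iid_normal_orthonormal x f : (p <= n)%N -> iid_normal P s f ->
  (forall a b, \sum_k x a k * x b k = (a == b)%:R) ->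
  iid_normal P s (fun a w => \sum_k x a k * f k w).
Proof.
move=> pn fN gramx.
have single (F : 'I_n -> R) (l : 'I_n) : (forall k : 'I_n, k != l -> F k = 0) ->
    \sum_k F k = F l.
  by move=> F0; rewrite (bigD1 l)//= big1 ?addr0.
(* The first [m] rows are brought to multiples of the first [m] unit vectors. Row [m] is then
   cleared to the right of its diagonal entry. *)
have diag m : (m <= p)%N -> exists y g, same_forms x f y g /\
    forall (a : 'I_p) (k : 'I_n), (a < m)%N -> k != widen_ord pn a -> y a k = 0.
  elim: m => [_|m IH mp]; first by exists x, f; split => //; split.
  have [y [g [yg yd]]] := IH (ltnW mp).
  pose am := Ordinal mp; pose im := widen_ord pn am.
  have [gN gram _] := yg.
  have imr : im \notin [seq k : 'I_n <- enum 'I_n | (m < k)%N].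
    by rewrite mem_filter ltnn.
  have [z [h [zh zr zy]]] := givens_elimination y g im am _ gN imr.
  have {}zr (k : 'I_n) : (m < k)%N -> z am k = 0.
    by move=> mk; apply: zr; rewrite mem_filter mk mem_enum.
  have {}zy b (k : 'I_n) : (k < m)%N -> z b k = y b k.
    move=> km; apply: zy; rewrite inE mem_filter negb_or negb_and -leqNgt (ltnW km).
    by rewrite -val_eqE/= neq_ltn km.
  have xzh := same_forms_trans _ _ _ _ _ _ yg zh.
  have [_ gramz _] := xzh.
  (* Earlier rows keep their diagonal entry, of square 1; their unit norm forces all the other
     entries to remain 0. *)
  have zb (b : 'I_p) : (b < m)%N -> z b (widen_ord pn b) ^+ 2 = 1 /\
      forall k, k != widen_ord pn b -> z b k = 0.
    move=> bm; have zb1 : z b (widen_ord pn b) ^+ 2 = 1.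
      have <- : \sum_k y b k * y b k = 1 by rewrite gram gramx eqxx.
      by rewrite zy// (single _ (widen_ord pn b)) ?expr2// => k kb;
        rewrite yd ?mul0r.
    split=> // k kb; have /eqP := gramz b b.
    rewrite gramx eqxx (bigD1 (widen_ord pn b))//= -expr2 zb1.
    rewrite -subr_eq0 addrAC subrr add0r psumr_eq0 => [/allP/(_ k)|l _].
      by rewrite mem_index_enum kb/= -expr2 sqrf_eq0 => /(_ isT)/eqP.
    by rewrite -expr2 sqr_ge0.
  exists z, h; split=> // a k; rewrite ltnS leq_eqVlt => /predU1P[am_|]; last first.
    by move=> /zb[_ za]; exact: za.
  have -> : a = am by exact: val_inj.
  move=> kim; have [mk|km|mk] := ltngtP m k; first exact: zr; last first.
    by rewrite -val_eqE/= mk eqxx in kim.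
  have kp : (k < p)%N by exact: (ltn_trans km).
  have kE : widen_ord pn (Ordinal kp) = k by exact: val_inj.
  have [zk1 zk0] := zb (Ordinal kp) km.
  (* To the left of the diagonal, orthogonality of row [m] to row [k], which is a signed unit
     vector, makes the entry at [k] vanish. *)
  have := gramz (Ordinal kp) am; rewrite gramx (single _ k); last first.
    by move=> l lk; rewrite zk0 ?mul0r// kE.
  rewrite (_ : _ == _ = false); last by rewrite -val_eqE/= ltn_eqF.
  move=> /eqP; rewrite mulf_eq0 => /orP[/eqP zk|/eqP//].
  by move/eqP: zk1; rewrite kE zk expr0n eq_sym oner_eq0.
have [y [g [[gN gramy pairy] yd]]] := diag p (leqnn p).
have -> : (fun a w => \sum_k x a k * f k w) =
    (fun a w => y a (widen_ord pn a) * g (widen_ord pn a) w).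
  apply/funext => a; apply/funext => w; rewrite -pairy.
  by rewrite (single _ (widen_ord pn a))// => k ka; rewrite yd ?mul0r.
apply: iid_normal_signed_sub => // [a b /(congr1 val)/= ab|a]; first exact: val_inj.
have := gramy a a; rewrite gramx eqxx (single _ (widen_ord pn a)) ?expr2// => k ka.
by rewrite yd ?mul0r.
Qed.

End elimination.

Arguments iid_normal_orthonormal {R d T P s} s0 {n p} x {f}.

(** * Which variable is the largest in absolute value *)

Lemma measurable_set_ltr d (T : measurableType d) (R : realType) (f g : T -> R) :
  measurable_fun setT f -> measurable_fun setT g -> measurable [set w | f w < g w].
Proof.
move=> mf mg; rewrite (_ : [set _ | _] = (fun w => f w < g w) @^-1` [set true]).
  rewrite -[X in measurable X]setTI.
  exact: (measurable_fun_ltr mf mg measurableT).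
by apply/seteqP; split.
Qed.

Lemma ae_eq_measure d (T : measurableType d) (R : realType)
    (m : {measure set T -> \bar R}) (A B : set T) :
  measurable A -> measurable B -> {ae m, forall w, A w <-> B w} -> m A = m B.
Proof.
move=> mA mB [N [mN N0 ABN]].
rewrite -(measureU0 mA mN N0) -(measureU0 mB mN N0); congr (m _).
have AB w : ~ N w -> (A w <-> B w).
  by move=> Nw; apply: contrapT => ABw; apply: Nw; exact: ABN.
apply/seteqP; split=> w; (case=> [ABw|]; last by right);
  by have [|/AB ABE] := pselect (N w); [right|left; apply/ABE].
Qed.

(** Boxes, unlike one-coordinate cylinders, are stable under intersection, as uniqueness of measures
    requires. *)
Lemma measurable_tuple_boxes (R : realType) n :
  @measurable _ (n.-tuple R) =
  <<s [set \bigcap_(i in setT) ((fun t : n.-tuple R => tnth t i) @^-1` B i) |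
        B in [set B : 'I_n -> set R | forall i, measurable (B i)]] >>.
Proof.
apply/seteqP; split.
  apply: smallest_sub; first exact: smallest_sigma_algebra.
  move=> A; rewrite -bigcup_seq => -[i _ [B mB <-]]; apply: sub_sigma_algebra.
  exists (fun j => if j == i then B else setT).
    by move=> j /=; case: ifP => _ //; exact: measurableT.
  apply/seteqP; split=> t /=; first by move=> /(_ i I); rewrite /= eqxx.
  by move=> [_ Bt] j _ /=; case: eqP => [->|].
apply: smallest_sub; first exact: sigma_algebra_measurable.
move=> _ [B mB <-]; apply: fin_bigcap_measurable => [|i _];
  first exact: finite_finset.
by rewrite -[X in measurable X]setTI; exact: measurable_tnth.
Qed.

(** * Ties and domination among i.i.d. normal variables *)

Section iid_normal_law.
Context {R : realType} d (T : measurableType d) (P : probability T R) (s : R).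
Hypothesis s0 : s != 0.

Lemma iid_normal_law n (f g : 'I_n -> T -> R) (D : set (n.-tuple R)) :
  iid_normal P s f -> iid_normal P s g -> measurable D ->
  P [set w | D [tuple f i w | i < n]] = P [set w | D [tuple g i w | i < n]].
Proof.
move=> [mf fN] [mg gN] mD.
have mtuple (h : 'I_n -> T -> R) : (forall i, measurable_fun setT (h i)) ->
    measurable_fun setT (fun w => [tuple h i w | i < n]).
  move=> mh; apply/measurable_fun_tnthP => i.
  by rewrite (_ : _ \o _ = h i)//; apply/funext => w /=; rewrite tnth_mktuple.
unshelve refine (let mu1 : {measure set (n.-tuple R) -> \bar R} :=
  pushforward P (fun w => [tuple f i w | i < n]) in _); first exact: mtuple.
unshelve refine (let mu2 : {measure set (n.-tuple R) -> \bar R} :=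
  pushforward P (fun w => [tuple g i w | i < n]) in _); first exact: (mtuple g).
suff : mu1 D = mu2 D by [].
have boxE (h : 'I_n -> T -> R) B :
    (fun w => [tuple h i w | i < n]) @^-1`
      (\bigcap_(i in setT) ((fun t : n.-tuple R => tnth t i) @^-1` B i)) =
    \bigcap_(i in setT) (h i @^-1` B i).
  apply/seteqP; split=> w /= Bw i _; first by have := Bw i I;
    rewrite /= tnth_mktuple.
  by rewrite /= tnth_mktuple; exact: Bw.
apply: (measure_unique _ (fun=> setT) (measurable_tuple_boxes R n)) => //.
- move=> _ _ [A mA <-] [B mB <-]; exists (fun i => A i `&` B i).
    by move=> i; exact: (measurableI _ _ (mA i) (mB i)).
  apply/seteqP; split=> t /= => [ABt|[At Bt] i _]; last by split;
    [exact: At|exact: Bt].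
  by split=> i _; have [] := ABt i I.
- move=> _; exists (fun=> setT); first by move=> i; exact: measurableT.
  by apply/seteqP; split.
- by rewrite bigcup_const.
- move=> _ [B mB <-]; rewrite /mu1 /mu2/= /pushforward !boxE.
  by rewrite fN// gN.
- by move=> _; rewrite /mu1/= /pushforward preimage_setT probability_setT ltry.
Qed.

Lemma iid_normal_ties n (f : 'I_n -> T -> R) : iid_normal P s f ->
  {ae P, forall w, (forall i, f i w != 0) /\
                   (forall i j, i != j -> `|f i w| != `|f j w|)}.
Proof.
move=> fN.
have null0 (g : 'I_n -> T -> R) i : iid_normal P s g -> {ae P, forall w, g i w !=
  0}.
  move=> gN; exists (g i @^-1` [set 0]); split.
  - by have [mg _] := gN; rewrite -[X in measurable X]setTI; exact: mg.
  - rewrite (iid_normal_marginal _ gN)//.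
    exact: normal_prob_set1.
  - by move=> w /= /negP; rewrite negbK => /eqP.
have nulle (i j : 'I_n) (e : R) : i != j -> e ^+ 2 = 1 ->
    {ae P, forall w, f j w != e * f i w}.
  (* The rotation with cosine [a] and sine [a * e] sends coordinate [j] to [a * (f j - e * f i)],
     again a normal variable, so a tie amounts to its vanishing. *)
  move=> ij e1; pose a : R := (Num.sqrt 2)^-1.
  have a0 : a != 0 by rewrite invr_eq0 gt_eqF// sqrtr_gt0.
  have a2 : a ^+ 2 = 2^-1 by rewrite exprVn sqr_sqrtr.
  have e0 : e != 0.
    by apply/eqP => e0; move/eqP: e1; rewrite e0 expr0n eq_sym oner_eq0.
  have ae1 : a ^+ 2 + (a * e) ^+ 2 = 1 by rewrite exprMn e1 a2; field.
  have := null0 _ j (iid_normal_givens s0 ij ae1 (mulf_neq0 a0 e0) fN).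
  apply: filterS => w; rewrite /givens [j == i]eq_sym (negbTE ij) eqxx.
  by apply: contra => /eqP ->; apply/eqP; ring.
have f0 : {ae P, forall w, forall i, f i w != 0}.
  by apply: filter_forall => i; exact: null0.
suff fneq : {ae P, forall w, forall i j, i != j -> `|f i w| != `|f j w|}.
  by apply: filterS2 f0 fneq => w.
apply: filter_forall => i; apply: filter_forall => j; have [->|ij] := eqVneq i j;
  first exact: aeW.
have N1 : (-1) ^+ 2 = 1 :> R by rewrite sqrrN expr1n.
apply: filterS2 (nulle i j 1 ij (expr1n _ _)) (nulle i j (-1) ij N1) => w.
rewrite mul1r mulN1r => fij fijN _; rewrite eqr_norm2 negb_or eq_sym fij/=.
by apply: contra fijN => /eqP ->; rewrite opprK.
Qed.

(* For [q.+2] variables this forces [0 < e * f i w]. *)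
Definition dominates n (f : 'I_n -> T -> R) (i : 'I_n) (e : R) : set T :=
  [set w | forall j, j != i -> `|f j w| < e * f i w].

Lemma measurable_dominates n (f : 'I_n -> T -> R) i e :
  (forall j, measurable_fun setT (f j)) -> measurable (dominates n f i e).
Proof.
move=> mf; rewrite (_ : dominates _ _ _ _ =
    \bigcap_(j in [set j | j != i]) [set w | `|f j w| < e * f i w]); last first.
  by apply/seteqP; split.
apply: fin_bigcap_measurable => [|j _]; first exact: finite_finset.
apply: measurable_set_ltr; first exact: measurableT_comp.
exact: measurable_funM.
Qed.

Lemma dominates_invariant q (f : 'I_q.+1 -> T -> R) i e : iid_normal P s f ->
  e ^+ 2 = 1 -> P (dominates q.+1 f i e) = P (dominates q.+1 f ord0 1).
Proof.
move=> fN e1; pose D : set (q.+1.-tuple R) :=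
  \bigcap_(j in [set j | j != ord0]) [set t | `|tnth t j| < tnth t ord0].
have mD : measurable D.
  apply: fin_bigcap_measurable => [|j _]; first exact: finite_finset.
  apply: measurable_set_ltr; last exact: measurable_tnth.
  by apply: measurableT_comp => //; exact: measurable_tnth.
have DE (g : 'I_q.+1 -> T -> R) :
    [set w | D [tuple g i w | i < q.+1]] = dominates q.+1 g ord0 1.
  apply/seteqP; split=> w /= Dw j j0; have := Dw j j0;
    by rewrite /= !tnth_mktuple mul1r.
(* Exchanging coordinates 0 and [i] and multiplying all of them by the sign [e] keeps the joint law
   and turns one domination event into the other. *)
pose g a w := e * f (tperm ord0 i a) w.
have gN : iid_normal P s g.
  by apply: iid_normal_signed_sub => //; exact: perm_inj.
rewrite -(DE f) (iid_normal_law _ _ _ _ fN gN mD) DE; congr (P _).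
have eN x : `|e * x| = `|x|.
  by move/eqP: e1; rewrite sqrf_eq1 => /orP[] /eqP ->;
    rewrite ?mul1r// mulN1r normrN.
apply/seteqP; split=> w /= gw j ji.
  by rewrite /g eN mul1r tpermL; apply: gw;
    rewrite -[X in _ != X](tpermL ord0 i) (inj_eq perm_inj).
have := gw (tperm ord0 i j); rewrite /g tpermK eN mul1r tpermL; apply.
by rewrite -[X in _ != X](tpermR ord0 i) (inj_eq perm_inj).
Qed.

Lemma prob_dominates q (f : 'I_q.+2 -> T -> R) : iid_normal P s f ->
  P (dominates q.+2 f ord0 1) = ((2 * q.+2%:R)^-1)%:E.
Proof.
move=> fN; have [mf _] := fN.
set c := P (dominates _ _ _ _).
pose C i := dominates q.+2 f i 1 `|` dominates q.+2 f i (-1).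
have mC i : measurable (C i) by apply: measurableU; exact: measurable_dominates.
(* A second index makes the two signs exclusive: [f i] and [- f i] cannot both exceed some
   [|f j|]. *)
have other (i : 'I_q.+2) : exists j, j != i.
  by exists (lift i ord0); rewrite eq_sym neq_lift.
have CE i w : C i w <-> forall j, j != i -> `|f j w| < `|f i w|.
  split=> [[Ci|Ci] j ji|Ci].
  - by have := Ci j ji; rewrite mul1r => /lt_le_trans; apply; exact: ler_norm.
  - have := Ci j ji; rewrite mulN1r => /lt_le_trans; apply.
    by rewrite -normrN; exact: ler_norm.
  have [fi|fi] := leP 0 (f i w); [left|right] => j ji.
    by rewrite mul1r -(ger0_norm fi); exact: Ci.
  by rewrite mulN1r -(ltr0_norm fi); exact: Ci.
have PC i : P (C i) = (c + c)%E.
  rewrite measureU; try exact: measurable_dominates.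
    have N1 : (-1) ^+ 2 = 1 :> R by rewrite sqrrN expr1n.
    by congr (_ + _)%E; apply: dominates_invariant => //; rewrite expr1n.
  apply/seteqP; split=> // w [Ci Ci']; have [j ji] := other i.
  have := Ci j ji; have := Ci' j ji; rewrite mul1r mulN1r.
  have := normr_ge0 (f j w); lra.
have tC : trivIset setT C.
  apply/trivIsetP => i j _ _ ij; apply/seteqP; split=> // w [/CE Ci /CE Cj].
  by have := Ci j; rewrite eq_sym ij => /(_ isT); rewrite ltNge ltW// Cj.
(* Without ties, the index of the largest absolute value dominates strictly, so the disjoint events
   [C i] cover almost everything. *)
have sum1 : (\sum_(i < q.+2) P (C i) = 1)%E.
  rewrite -measure_bigsetU_ord// -(@probability_setT _ _ _ P).
  apply: ae_eq_measure => //; first exact: bigsetU_measurable.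
  apply: filterS (iid_normal_ties _ _ fN) => w [_ fw]; split=> // _.
  rewrite -bigcup_seq; pose i := [arg max_(i > ord0) `|f i w|]%O.
  exists i; first by rewrite /= mem_index_enum.
  apply/CE => j ji; rewrite lt_neqAle fw//=.
  by rewrite /i; case: arg_maxP => // k _; apply.
have cfin : c \is a fin_num.
  exact: (fin_num_measure P _ (measurable_dominates _ _ _ _ mf)).
move: sum1; rewrite (eq_bigr (fun=> (c + c)%E))// -(fineK cfin) -EFinD.
rewrite sumEFin sumr_const card_ord -[(_ + _) *+ _]mulr_natr => -[].
have : q.+2%:R != 0 :> R by rewrite pnatr_eq0.
move: (fine c) (q.+2%:R : R) => a N N0 aN1; congr EFin.
rewrite -[RHS]div1r; apply: (canRL (mulfK _)); first by rewrite mulf_neq0.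
by rewrite -[RHS]aN1; ring.
Qed.

Lemma prob_exceeds q (f : 'I_q.+2 -> T -> R) b : 0 < s -> 0 < b ->
  iid_normal P s f ->
  P [set w | 0 < b + f ord0 w /\
     exists2 j, j != ord0 & Num.max (f ord0 w) 0 < `|f j w|] =
  (Phi (b / s) - ((2 * q.+2%:R)^-1)%:E)%E.
Proof.
move=> sgt0 b0 fN; have [mf _] := fN.
pose A := f ord0 @^-1` `]- b, +oo[.
have mA : measurable A by rewrite -[X in measurable X]setTI; exact: mf.
have mD := measurable_dominates _ _ ord0 1 mf.
have PA : P A = Phi (b / s).
  rewrite (iid_normal_marginal _ fN (measurable_itv _)) -normal_prob_itvNyc//.
  (* The endpoint [b] has probability 0, and reflection exchanges []- b, +oo[] and []-oo, b[]. *)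
  rewrite -(@setUitv1 _ R -oo%O b true)// measureU//; last first.
    by apply/seteqP; split=> // x [/= + xb]; rewrite in_itv/= xb ltxx.
  rewrite [X in (_ + X)%E](normal_prob_set1 s) adde0.
  rewrite -[RHS](normal_prob_opp _ _ s0 (measurable_itv _));
    congr (normal_prob _ _ _).
  by apply/seteqP; split=> x /=; rewrite !in_itv/= andbT ltrNl.
rewrite -PA -(prob_dominates _ _ fN).
have /setIidr DA : dominates q.+2 f ord0 1 `<=` A.
  move=> w Dw; rewrite /A/= in_itv/= andbT.
  have := Dw (lift ord0 ord0); rewrite eq_sym neq_lift mul1r => /(_ isT).
  have := normr_ge0 (f (lift ord0 ord0) w); lra.
rewrite -[X in (_ - P X)%E]DA -measureD//; last first.
  by rewrite -ge0_fin_numE//; exact: (fin_num_measure P).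
(* Off the ties, failure of domination gives some [|f j| >= f ord0]. This is strict if [f ord0 > 0]
   since absolute values differ; if [f ord0 <= 0], the maximum is 0 and [f j != 0] suffices. *)
apply: ae_eq_measure; last first.
- apply: filterS (iid_normal_ties _ _ fN) => w [f0 fneq];
  rewrite /A /= in_itv/= andbT.
  split=> [[fb [j j0 fj]]|[fb Dw]].
    split; first by lra.
    move=> /(_ j j0); rewrite mul1r; apply/negP; rewrite -leNgt ltW//.
    by apply: le_lt_trans fj; rewrite le_max lexx.
  split; first by lra.
  have /existsNP[j /not_implyP[j0 /negP]] := Dw; rewrite mul1r -leNgt => fj.
  exists j => //; have [fle|fgt] := leP (f ord0 w) 0; first by rewrite normr_gt0.
  by rewrite lt_neqAle fj andbT -(gtr0_norm fgt) fneq// eq_sym.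
- exact: measurableD.
rewrite (_ : [set _ | _] = [set w | 0 < b + f ord0 w] `&`
  \bigcup_(j in [set j | j != ord0]) [set w | Num.max (f ord0 w) 0 < `|f j w|]);
    last first.
  by apply/seteqP; split.
apply: measurableI; first by apply: measurable_set_ltr => //;
  exact: measurable_funD.
apply: fin_bigcup_measurable => [|j _]; first exact: finite_finset.
apply: measurable_set_ltr; first exact: measurable_maxr.
exact: measurableT_comp.
Qed.

End iid_normal_law.

(** * From the Lasso model to i.i.d. normal variables *)

Theorem theorem2p1 {R : realType} (d : measure_display) (T : measurableType d)
    (P : probability T R) (n p : nat) (X : 'M[R]_(n, p)) (beta1 sigma : R)
    (eps : 'I_n -> {RV P >-> R}) :
  (1 < p)%N -> (p <= n)%N ->
  X^T *m X = 1%:M ->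
  beta1 != 0 -> 0 < sigma ->
  mutually_independent eps ->
  (forall i A, measurable A -> distribution P (eps i) A = normal_prob 0 sigma A) ->
  P [set w | minval (Lp n beta1 (zvec X beta1 eps w))
             > minval (L1 n beta1 (zvec X beta1 eps w))] =
  (Phi (`|beta1| / sigma) - ((2 * p%:R)^-1)%:E)%E.
Proof.
case: p X => [|[|q]]// X _ pn XX b0 s0 indep law.
have sN0 : sigma != 0 by rewrite gt_eqF.
have n0 : (0 < n)%N by exact: leq_trans pn.
have epsN : iid_normal P sigma (fun i => eps i : T -> R).
  split=> [i|B mB]; first exact: measurable_funP.
  by rewrite indep//; apply: eq_bigr => i _; exact: law.
have uN := iid_normal_orthonormal sN0 (fun a k => X k a) pn epsN.
have {}uN : iid_normal P sigma (fun (a : 'I_q.+2) w => \sum_k X k a * eps k w).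
  apply: uN => a b; have /matrixP/(_ a b) := XX; rewrite !mxE => <-.
  by apply: eq_bigr => k _; rewrite mxE.
(* All coordinates of the noise are multiplied by the sign of [beta1]: the signed [z_1] becomes
   [|beta1| + g ord0], and the other absolute values do not change. *)
pose g (a : 'I_q.+2) w := Num.sg beta1 * \sum_k X k a * eps k w.
have gN : iid_normal P sigma g.
  by apply: (iid_normal_signed_sub sN0 _ _ uN (h := id)) => // a; rewrite sqr_sg b0.
have bgt0 : 0 < `|beta1| by rewrite normr_gt0.
rewrite -(prob_exceeds _ _ P sigma sN0 q g _ s0 bgt0 gN); congr (P _).
have zE w j : zvec X beta1 eps w j 0 =
    (if j == ord0 then beta1 else 0) + \sum_k X k j * eps k w.
  rewrite /zvec mulmxDr mulmxA XX mul1mx !mxE; congr (_ + _).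
  by apply: eq_bigr => k _; rewrite !mxE.
have z0 w : Num.sg beta1 * zvec X beta1 eps w ord0 0 = `|beta1| + g ord0 w.
  by rewrite zE eqxx mulrDr -normrEsg.
have zj w j : j != ord0 -> `|zvec X beta1 eps w j 0| = `|g j w|.
  by move=> /negbTE j0; rewrite zE j0 add0r /g normrM normr_sg b0 mul1r.
apply/seteqP; split=> w /=.
  move=> /(minval_L1_lt_Lp _ _ _ _ n0 b0)[];
    rewrite z0 addrAC subrr add0r => ? [j j0].
  by rewrite zj// => ?; split=> //; exists j.
move=> [? [j j0 fj]]; apply/(minval_L1_lt_Lp _ _ _ _ n0 b0).
by rewrite z0 addrAC subrr add0r; split=> //; exists j => //; rewrite zj.
Qed.
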